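(* Let $\Sigma$ be a finite propositional signature, let $v\in\mathcal I$ be a partial interpretation and let $\alpha$ be a formula over $\Sigma$. Then: (i) $v(\alpha)=2$ (in the $G_3$ valuation) if and only if $v\in[\![\alpha]\!]$; (ii) $v(\alpha)\neq 0$ (in the $G_3$ valuation) if and only if $v_t\in[\![\alpha]\!]$.
   Context: $\Sigma$ is a finite set of atoms. Formulas are given by $\alpha ::= \bot \mid p \mid \alpha_1\wedge\alpha_2 \mid \alpha_1\vee\alpha_2 \mid \alpha_1\rightarrow\alpha_2$ with $p\in\Sigma$. A partial interpretation is a map $v:\Sigma\to\{0,1,2\}$; $\mathcal I$ is the set of all partial interpretations and $\mathcal I_c\subseteq\mathcal I$ the set of classical ones (those with $v(p)\neq 1$ for all $p$). For $v\in\mathcal I$, $v_t\in\mathcal I_c$ is defined by $v_t(p)=2$ if $v(p)=1$ and $v_t(p)=v(p)$ otherwise. The $G_3$ valuation extends $v$ to formulas: $v(\bot)=0$, $v(\alpha\wedge\beta)=\min(v(\alpha),v(\beta))$, $v(\alpha\vee\beta)=\max(v(\alpha),v(\beta))$, $v(\alpha\to\beta)=2$ if $v(\alpha)\le v(\beta)$ and $v(\alpha\to\beta)=v(\beta)$ otherwise. The order on $\mathcal I$: $u\le v$ iff for every atom $p$, $u(p)\le v(p)$ and ($u(p)=0$ implies $v(p)=0$). For $S\subseteq\mathcal I$: $\overline S=\mathcal I\setminus S$; $S_c=S\cap\mathcal I_c$; $S\downarrow=\{u\in\mathcal I:\exists v\in S,\ v\ge u\}$; $S\uparrow=\{u\in\mathcal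 I:\exists v\in S,\ v\le u\}$ (these three postfix operations bind tighter than $\cup,\cap,\setminus$ and are applied left to right, so $S_c\downarrow=(S_c)\downarrow$). The denotation $[\![\cdot]\!]$ is defined recursively: $[\![\bot]\!]=\emptyset$; $[\![p]\!]=\{v\in\mathcal I: v(p)=2\}$; $[\![\alpha\wedge\beta]\!]=[\![\alpha]\!]\cap[\![\beta]\!]$; $[\![\alpha\vee\beta]\!]=[\![\alpha]\!]\cup[\![\beta]\!]$; $[\![\alpha\to\beta]\!]=\big(\overline{[\![\alpha]\!]}\cup[\![\beta]\!]\big)\cap\big(\overline{[\![\alpha]\!]}\cup[\![\beta]\!]\big)_c\downarrow$. *)

(* Defs.v *)
From mathcomp Require Import all_boot all_order.

Set Implicit Arguments.
Unset Strict Implicit.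
Unset Printing Implicit Defensive.

Inductive formula (Sigma : finType) : Type :=
  | FBot
  | FAtom of Sigma
  | FAnd of formula Sigma & formula Sigma
  | FOr of formula Sigma & formula Sigma
  | FImp of formula Sigma & formula Sigma.

Arguments FBot {Sigma}.

(* Truth values 0, 1, 2 are the elements of 'I_3. *)
Notation interp Sigma := {ffun Sigma -> 'I_3}.

Section Semantics.

Variable Sigma : finType.
Implicit Types (u v : interp Sigma) (S : {set interp Sigma}).

(* [ord0] is 0 and [ord_max] is 2. *)
Fixpoint valuation v (a : formula Sigma) : 'I_3 :=
  match a with
  | FBot => ord0
  | FAtom p => v p
  | FAnd b c => Order.min (valuation v b) (valuation v c)
  | FOr b c => Order.max (valuation v b) (valuation v c)
  | FImp b c =>
      if valuation v b <= valuation v c then ord_max else valuation v c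
  end.

Definition totalize v : interp Sigma :=
  [ffun p => if v p == 1 :> nat then ord_max else v p].

Definition le_interp u v : bool :=
  [forall p, (u p <= v p) && ((u p == 0 :> nat) ==> (v p == 0 :> nat))].

Definition classical_interps : {set interp Sigma} :=
  [set v : interp Sigma | [forall p, v p != 1 :> nat]].

Definition cpart S : {set interp Sigma} := S :&: classical_interps.

Definition down S : {set interp Sigma} :=
  [set u : interp Sigma | [exists v in S, le_interp u v]].

Fixpoint denot (a : formula Sigma) : {set interp Sigma} :=
  match a with
  | FBot => set0
  | FAtom p => [set v : interp Sigma | v p == 2 :> nat]
  | FAnd b c => denot b :&: denot c
  | FOr b c => denot b :|: denot c
  | FImp b c =>
      (~: denot b :|: denot c) :&: down (cpart (~: denot b :|: denot c))
  end.

End Semantics.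

(* Main.v *)
Require Import Defs.
From mathcomp Require Import all_boot all_order.

(** The totalization of [v] is the only classical interpretation above [v], so
    [v \in down (cpart S)] just means [totalize v \in S].  Both equivalences
    then follow by a simultaneous induction on the formula, the implication
    case being a check of the nine pairs of truth values. *)

Lemma totalize_classical (Sigma : finType) (v : interp Sigma) :
  totalize v \in classical_interps Sigma.
Proof.
rewrite inE; apply/forallP => p; rewrite ffunE.
by case: ifP => // /negbT.
Qed.

Lemma totalize_id (Sigma : finType) (v : interp Sigma) :
  v \in classical_interps Sigma -> totalize v = v.
Proof.
rewrite inE => /forallP v_classical; apply/ffunP => p; rewrite ffunE.
by rewrite (negbTE (v_classical p)).
Qed.

(** Going up in [le_interp] fixes the values 0 and 2 and can only turn 1 into 2; a classical [w]
    must do so at every such atom. *)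
Lemma le_interp_classical (Sigma : finType) (v w : interp Sigma) :
  w \in classical_interps Sigma -> le_interp v w = (w == totalize v).
Proof.
rewrite inE => /forallP w_classical; apply/forallP/eqP => [le_vw | -> p].
  apply/ffunP => p; apply: val_inj; rewrite ffunE.
  move: (w_classical p) (le_vw p).
  by case: (v p) (w p) => [[|[|[|?]]] ?] [[|[|[|?]]] ?].
by rewrite ffunE; case: (v p) => [[|[|[|?]]] ?].
Qed.

Lemma mem_down_cpart (Sigma : finType) (S : {set interp Sigma})
    (v : interp Sigma) :
  (v \in down (cpart S)) = (totalize v \in S).
Proof.
rewrite inE; apply/exists_inP/idP => [[w] | tvS].
  by rewrite inE => /andP[wS w_classical]; rewrite le_interp_classical // => /eqP <-.
exists (totalize v); first by rewrite inE tvS totalize_classical.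
by rewrite le_interp_classical ?totalize_classical.
Qed.

(** This is the Kripke clause of here-and-there logic, with [v] as the here world and [totalize v]
    as the there world. *)
Lemma mem_denot_imp (Sigma : finType) (v : interp Sigma) (b c : formula Sigma) :
  (v \in denot (FImp b c)) =
    ((v \in denot b) ==> (v \in denot c)) &&
    ((totalize v \in denot b) ==> (totalize v \in denot c)).
Proof. by rewrite /= in_setI mem_down_cpart !in_setU !in_setC !implybE. Qed.

(** The first equality is not inductive alone: at an implication it also needs the subformulas at
    [totalize v]. *)
Lemma mem_denot (Sigma : finType) (v : interp Sigma) (a : formula Sigma) :
  (v \in denot a) = (valuation v a == 2 :> nat) /\
  (totalize v \in denot a) = (valuation v a != 0 :> nat).
Proof.
elim: a => [|p|b [vb tb] c [vc tc]|b [vb tb] c [vc tc]|b [vb tb] c [vc tc]].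
- by rewrite !in_set0.
- by rewrite !inE ffunE /=; case: (v p) => [[|[|[|?]]] ?].
- rewrite /= !in_setI vb tb vc tc.
  by case: (valuation v b) (valuation v c) => [[|[|[|?]]] ?] [[|[|[|?]]] ?].
- rewrite /= !in_setU vb tb vc tc.
  by case: (valuation v b) (valuation v c) => [[|[|[|?]]] ?] [[|[|[|?]]] ?].
(* At [totalize v] both conjuncts of [mem_denot_imp] coincide, as totalizing is idempotent. *)
- rewrite !mem_denot_imp (@totalize_id _ (totalize v)) ?totalize_classical //.
  rewrite vb tb vc tc /=.
  by case: (valuation v b) (valuation v c) => [[|[|[|?]]] ?] [[|[|[|?]]] ?].
Qed.

Theorem theorem1 (Sigma : finType) (v : interp Sigma) (a : formula Sigma) :
  (valuation v a = 2 :> nat <-> v \in denot a) /\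
  (valuation v a <> 0 :> nat <-> totalize v \in denot a).
Proof.
have [-> ->] := @mem_denot _ v a.
by split; split=> /eqP.
Qed.
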